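(* Let $W$ be a simply laced Weyl group. Let $v\in W$ be a shuffle element with pivot element $\beta$. Let $w\in W$ be such that $s_\beta v\lessdot w$. Then $s_\beta w<w$.
   Context: $R$ is a simply laced root system, i.e. a reduced, irreducible, crystallographic root system whose Dynkin diagram has only simple edges (types $\mathsf A_n,\mathsf D_n,\mathsf E_6,\mathsf E_7,\mathsf E_8$); $W$ is its Weyl group (a simply laced Weyl group), $\Delta$ a fixed base of simple roots, $s_\alpha$ the reflection in a root $\alpha$. $\leq$ (strictly: $<$) is the (strong) Bruhat order on $W$ with respect to the simple reflections $s_\beta$, $\beta\in\Delta$, and $\lessdot$ is its covering relation. For $v\in W$, $A_\ell(v)=\{\beta\in\Delta: v<s_\beta v\}$. An element $v\in W$ is a shuffle element if $A_\ell(v)$ consists of a unique element; that element is called the pivot element of $v$. *)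

(* Defs.v *)
From Stdlib Require Export Relation_Operators.
From mathcomp Require Export all_boot all_order all_algebra finmap.
From mathcomp Require Export boolp classical_sets reals.

Set Implicit Arguments.
Unset Strict Implicit.
Unset Printing Implicit Defensive.

Import Order.TTheory GRing.Theory Num.Theory.
Local Open Scope ring_scope.
Local Open Scope fset_scope.

Section RootSystems.
Context {R : realType} {n : nat}.
Implicit Types (a b x y : 'cV[R]_n) (u v w z : 'M[R]_n).
Implicit Types Phi Delta : {fset 'cV[R]_n}.

Definition dot x y : R := \sum_(i < n) x i 0 * y i 0.

(* The Cartan number <x, a^vee>. *)
Definition cartan x a : R := 2 * dot x a / dot a a.

(* The matrix, acting on column vectors by left multiplication, of the
   orthogonal reflection x |-> x - <x, a^vee> a. *)
Definition refl a : 'M[R]_n := 1%:M - (2 / dot a a) *: (a *m a^T).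

Record root_system Phi : Prop := RootSystem {
  root_neq0 : 0 \notin Phi;
  root_span : (<<Phi>> = fullv)%VS;
  root_refl : forall a b, a \in Phi -> b \in Phi -> refl a *m b \in Phi;
  root_int  : forall a b, a \in Phi -> b \in Phi -> cartan b a \is a Num.int
}.

Definition reduced Phi : Prop :=
  forall a (c : R), a \in Phi -> c *: a \in Phi -> c = 1 \/ c = -1.

Definition irreducible Phi : Prop :=
  Phi <> fset0 /\
  forall A : {fset 'cV[R]_n}, A `<=` Phi ->
    (forall a b, a \in A -> b \in Phi `\` A -> dot a b = 0) ->
    A = fset0 \/ A = Phi.

Record is_base Phi Delta : Prop := IsBase {
  base_sub   : Delta `<=` Phi;
  base_basis : basis_of fullv Delta;
  base_sign  : forall a, a \in Phi -> exists c : 'cV[R]_n -> nat,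
    a = \sum_(b <- Delta) b *+ c b \/ a = - \sum_(b <- Delta) b *+ c b
}.

(* The number of edges between the nodes a and b of the Dynkin diagram is
   <a, b^vee> <b, a^vee>. *)
Definition dynkin_edges a b : R := cartan a b * cartan b a.

Definition simply_laced Delta : Prop :=
  forall a b, a \in Delta -> b \in Delta -> a != b ->
    dynkin_edges a b = 0 \/ dynkin_edges a b = 1.

(* Reflections are involutions, so the subgroup of GL_n they generate is the
   set of their finite products. *)
Definition weyl_group Phi : set 'M[R]_n :=
  [set w | exists2 s : seq 'cV[R]_n,
             {subset s <= Phi} & w = \prod_(a <- s) refl a].

Definition has_word Delta w (k : nat) : bool :=
  [exists s : k.-tuple Delta, w == \prod_(b <- s) refl (val b)].

(* The value 0 outside the group generated by the simple reflections is a
   junk value. *)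
Definition coxeter_length Delta w : nat :=
  match pselect (exists k, has_word Delta w k) with
  | left ex_word => ex_minn ex_word
  | right _ => 0%N
  end.

Definition bruhat_step Phi Delta u w : Prop :=
  exists2 a, a \in Phi & w = refl a * u /\ (coxeter_length Delta u < coxeter_length Delta w)%N.

Definition bruhat_le Phi Delta : 'M[R]_n -> 'M[R]_n -> Prop :=
  clos_refl_trans _ (bruhat_step Phi Delta).

Definition bruhat_lt Phi Delta u w : Prop :=
  bruhat_le Phi Delta u w /\ u <> w.

Definition bruhat_cover Phi Delta u w : Prop :=
  bruhat_lt Phi Delta u w /\
  ~ exists2 z, weyl_group Phi z & bruhat_lt Phi Delta u z /\ bruhat_lt Phi Delta z w.

Definition left_ascents Phi Delta v : {fset 'cV[R]_n} :=
  [fset b in Delta | `[< bruhat_lt Phi Delta v (refl b * v) >]].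

Definition is_shuffle Phi Delta v : Prop := #|` left_ascents Phi Delta v| = 1%N.

Definition is_pivot Phi Delta v b : Prop :=
  is_shuffle Phi Delta v /\ b \in left_ascents Phi Delta v.

End RootSystems.

(* Main.v *)
From Stdlib Require Import Operators_Properties.
From mathcomp Require Import ring lra.
Require Import Defs.
Import Order.TTheory GRing.Theory Num.Theory.
Local Open Scope ring_scope.

Set Implicit Arguments.
Unset Strict Implicit.
Unset Printing Implicit Defensive.

(** Write [ht] for the height and [x > 0] for a root of positive height.  For a
    root [a > 0], left multiplication by [refl a] lengthens [u] exactly when
    [u^-1 a > 0] ([len_refl], [len_refl_pos]); this is the exchange property of
    words in the simple reflections ([exchange]).  So statements about the
    Bruhat order become statements about signs of roots.  Weyl group elements
    are orthogonal, and their inverses appear as transposes.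

    Put [u = refl beta * v], let [w = refl a * u] cover [u] with [a > 0], and let
    [phi x = ht (v^-1 x)].  That [v] is a shuffle element with pivot [beta] says
    that [phi] is positive on [beta] and negative on every other simple root.
    Suppose that [w^-1 beta > 0], against the claim.  Since [u^-1 a > 0] and
    [u^-1 beta < 0], the roots [a] and [beta] have negative pairing, which in a
    simply laced system is -1 ([cartan_neg]); hence [w^-1 beta = v^-1 a], and
    [phi a > 0].

    The heart of the proof ([pivot_split]) is that such an [a] is a sum [j + y]
    of two positive roots with [u^-1 j > 0] and [u^-1 y > 0].  Indeed [a] is
    [m beta] plus a sum of positive roots [p] with [phi p < 0], each pairing to
    -1 with [beta] ([outer_linked]).  Pairing this expression with [a] shows that
    at least [m + 2] of the [p] pair to 1 with [a].  If all of these satisfied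
    [phi p <= - phi beta], then [phi a] would be negative; so one of them, [j],
    has [phi (j + beta) > 0], which is [u^-1 j > 0].

    Since [refl a = refl j * refl y * refl j], the elements [u], [refl j * u],
    [refl y * refl j * u] and [w] are then four terms of a strict Bruhat chain,
    and [w] does not cover [u]. *)

(** * Inner products and reflections *)

Section Reflections.
Context {R : realType} {n : nat}.
Implicit Types (a b x y : 'cV[R]_n) (u v w g : 'M[R]_n).

Lemma dotE x y : x^T *m y = (dot x y)%:M.
Proof.
apply/matrixP=> i j; rewrite !ord1 !mxE eqxx mulr1n.
by apply: eq_bigr => k _; rewrite mxE.
Qed.

Lemma dotC x y : dot x y = dot y x.
Proof. by apply: eq_bigr => i _; rewrite mulrC. Qed.

Lemma dotDr x y z : dot x (y + z) = dot x y + dot x z.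
Proof. by rewrite -big_split; apply: eq_bigr => i _; rewrite mxE mulrDr. Qed.

Lemma dotZr c x y : dot x (c *: y) = c * dot x y.
Proof. by rewrite mulr_sumr; apply: eq_bigr => i _; rewrite mxE mulrCA. Qed.

Lemma dotNr x y : dot x (- y) = - dot x y.
Proof. by rewrite -scaleN1r dotZr mulN1r. Qed.

Lemma dotBr x y z : dot x (y - z) = dot x y - dot x z.
Proof. by rewrite dotDr dotNr. Qed.

Lemma dotDl x y z : dot (x + y) z = dot x z + dot y z.
Proof. by rewrite !(dotC _ z) dotDr. Qed.

Lemma dotNl x y : dot (- x) y = - dot x y.
Proof. by rewrite !(dotC _ y) dotNr. Qed.

Lemma dot0r x : dot x 0 = 0.
Proof. by rewrite -(scale0r 0) dotZr mul0r. Qed.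

Lemma dotMnr x y k : dot x (y *+ k) = dot x y *+ k.
Proof. by elim: k => [|k IH]; rewrite ?dot0r // !mulrS dotDr IH. Qed.

Lemma dot_sumr (I : Type) (s : seq I) (F : I -> 'cV[R]_n) x :
  dot x (\sum_(i <- s) F i) = \sum_(i <- s) dot x (F i).
Proof. by elim/big_rec2: _ => [|i y z _ <-]; rewrite ?dot0r ?dotDr. Qed.

Lemma dot_gt0 x : x != 0 -> 0 < dot x x.
Proof.
move=> x_neq0; rewrite lt_def sumr_ge0 ?andbT => [|i _]; last by rewrite -expr2 sqr_ge0.
apply: contra x_neq0 => /eqP/psumr_eq0P x0.
apply/eqP/matrixP=> i j; rewrite !ord1 mxE; apply/eqP.
by rewrite -sqrf_eq0 expr2 x0 // => k _; rewrite -expr2 sqr_ge0.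
Qed.

Lemma dot_mulmx g x y : dot x (g *m y) = dot (g^T *m x) y.
Proof.
have /matrixP/(_ 0 0) : x^T *m (g *m y) = (g^T *m x)^T *m y.
  by rewrite trmx_mul trmxK mulmxA.
by rewrite !dotE !mxE.
Qed.

Lemma cartanDl x y a : cartan (x + y) a = cartan x a + cartan y a.
Proof. by rewrite /cartan dotDl mulrDr mulrDl. Qed.

Lemma cartanNl x a : cartan (- x) a = - cartan x a.
Proof. by rewrite /cartan dotNl mulrN mulNr. Qed.

Lemma cartan_sum (s : seq 'cV[R]_n) a :
  cartan (\sum_(x <- s) x) a = \sum_(x <- s) cartan x a.
Proof.
rewrite /cartan dotC dot_sumr mulr_sumr mulr_suml.
by apply: eq_bigr => x _; rewrite dotC.
Qed.

Lemma cartanMnl x k a : cartan (x *+ k) a = cartan x a *+ k.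
Proof. by rewrite /cartan dotC dotMnr dotC mulrnAr mulrnAl. Qed.

Lemma cartan_id a : a != 0 -> cartan a a = 2.
Proof. by move=> a0; rewrite /cartan mulfK ?gt_eqF ?dot_gt0. Qed.

Lemma reflE a x : refl a *m x = x - cartan x a *: a.
Proof.
rewrite /refl mulmxBl mul1mx -scalemxAl -mulmxA dotE mul_mx_scalar scalerA.
by rewrite /cartan (dotC x) mulrAC.
Qed.

Lemma refl_id a : a != 0 -> refl a *m a = - a.
Proof. by move=> a0; rewrite reflE cartan_id // scaler_nat mulr2n opprD addrA subrr add0r. Qed.

Lemma refl_tr a : (refl a)^T = refl a.
Proof. by rewrite /refl linearB linearZ /= trmx_mul trmxK tr_scalar_mx. Qed.

Lemma reflN a : refl (- a) = refl a.
Proof. by rewrite /refl dotNl dotNr opprK linearN /= mulmxN mulNmx opprK. Qed.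

Lemma dot_refl a x y : dot (refl a *m x) y = dot x (refl a *m y).
Proof. by rewrite dot_mulmx refl_tr. Qed.

Lemma reflK a : a != 0 -> refl a * refl a = 1.
Proof.
move=> a0; have aa : dot a a != 0 by rewrite gt_eqF ?dot_gt0.
rewrite -mulmxE {2}/refl mulmxBr mulmx1 -scalemxAr mulmxA refl_id // mulNmx.
by rewrite scalerN opprK /refl subrK.
Qed.

Lemma actM u v x : (u * v) *m x = u *m (v *m x).
Proof. by rewrite -mulmxE mulmxA. Qed.

Lemma refl_actK a x : a != 0 -> refl a *m (refl a *m x) = x.
Proof. by move=> a0; rewrite -actM reflK // mul1mx. Qed.

Lemma dot_refl_refl a x y : a != 0 -> dot (refl a *m x) (refl a *m y) = dot x y.
Proof. by move=> a0; rewrite dot_refl refl_actK. Qed.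

Lemma refl_conj a b : b != 0 -> refl (refl b *m a) = refl b * refl a * refl b.
Proof.
move=> b0; rewrite {1}/refl dot_refl_refl // trmx_mul refl_tr.
move: (refl b) (reflK b0) => r rr.
rewrite /refl -!mulmxE mulmxBr mulmx1 mulmxBl mulmxE rr.
by congr (_ - _); rewrite -!mulmxE -scalemxAr -scalemxAl !mulmxA.
Qed.

Lemma refl_tr_mul a u : (refl a * u)^T = u^T * refl a.
Proof. by rewrite -mulmxE trmx_mul refl_tr. Qed.

End Reflections.

(** * Positive roots *)

Section RootSystem.
Context {R : realType} {n : nat} {Phi Delta : {fset 'cV[R]_n}}.
Hypotheses (Phi_root : root_system Phi) (Phi_reduced : reduced Phi).
Hypothesis Delta_base : is_base Phi Delta.
Implicit Types (a b x y : 'cV[R]_n) (u v w z : 'M[R]_n).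

Lemma root_nz x : x \in Phi -> x != 0.
Proof. by move=> xP; apply: contraNneq (root_neq0 Phi_root) => <-. Qed.

Lemma rootN x : x \in Phi -> - x \in Phi.
Proof. by move=> xP; rewrite -refl_id ?root_nz // root_refl. Qed.

Lemma base_root b : b \in Delta -> b \in Phi.
Proof. exact/fsubsetP/(base_sub Delta_base). Qed.

(** Linear functionals are given by vectors here, so that heights, coordinates
    and heights after a group element are all values of [dot]. *)
Lemma base_dual (t : 'cV[R]_n -> R) :
  exists r, forall b, b \in Delta -> dot r b = t b.
Proof.
pose X := in_tuple Delta; have XB : basis_of fullv X := base_basis Delta_base.
exists (\col_k \sum_i coord X i (delta_mx k 0) * t X`_i) => b bD.
have bi : (index b Delta < size Delta)%N by rewrite index_mem.
have Xb : X`_(Ordinal bi) = b by rewrite /= nth_index.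
transitivity (\sum_i coord X i b * t X`_i); last first.
  have cX i : coord X i b = (Ordinal bi == i)%:R.
    exact: etrans (f_equal (coord X i) (esym Xb)) (coord_free _ _ (basis_free XB)).
  rewrite (bigD1 (Ordinal bi)) //= cX eqxx mul1r Xb.
  by rewrite big1 ?addr0 // => i /negbTE ib; rewrite cX eq_sym ib mul0r.
have bE : b = \sum_k b k 0 *: delta_mx k 0.
  by rewrite {1}[b]matrix_sum_delta; apply: eq_bigr => k _; rewrite big_ord1.
under [RHS]eq_bigr => i _ do rewrite {1}bE linear_sum mulr_suml.
rewrite exchange_big; apply: eq_bigr => k _; rewrite mxE mulr_suml.
apply: eq_bigr => i _; rewrite linearZ /= mulrAC; congr (_ * _); exact: mulrC.
Qed.

(** Pairing with a vector [rho] that takes the value 1 on each simple root is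
    the height function; a root is positive when its height is. *)
Context (rho : 'cV[R]_n) (rho_base : forall b, b \in Delta -> dot rho b = 1).
Notation ht := (dot rho).
Definition pos x : Prop := x \in Phi /\ 0 < ht x.

Lemma ht_comb (c : 'cV[R]_n -> nat) :
  ht (\sum_(b <- Delta) b *+ c b) = (\sum_(b <- Delta) c b)%:R.
Proof.
rewrite dot_sumr natr_sum; apply: eq_big_seq => b bD.
by rewrite dotMnr rho_base.
Qed.

Lemma ht_comb_gt0 (c : 'cV[R]_n -> nat) (x := \sum_(b <- Delta) b *+ c b) :
  x != 0 -> 0 < ht x.
Proof.
apply: contra_neqT; rewrite ht_comb ltr0n lt0n negbK => /eqP c0.
rewrite /x big_seq big1 // => b bD.
suff -> : c b = 0%N by rewrite mulr0n.
by apply/eqP; rewrite -leqn0 -c0 (big_rem b) //= leq_addr.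
Qed.

Lemma pos_comb x : pos x -> exists c : 'cV[R]_n -> nat, x = \sum_(b <- Delta) b *+ c b.
Proof.
move=> [xP x_gt0]; have [c [->|xE]] := base_sign Delta_base xP; first by exists c.
have : 0 < ht (- x) by rewrite xE opprK ht_comb_gt0 // -oppr_eq0 -xE root_nz.
by rewrite dotNr oppr_gt0 ltNge ltW.
Qed.

Lemma pos_or_neg x : x \in Phi -> pos x \/ pos (- x).
Proof.
move=> xP; have x0 := root_nz xP; have [c [xE|xE]] := base_sign Delta_base xP.
  by left; split=> //; rewrite xE ht_comb_gt0 // -xE.
right; split; first exact: rootN.
by rewrite xE opprK ht_comb_gt0 // -oppr_eq0 -xE.
Qed.

Lemma ht_ge0_pos x : x \in Phi -> 0 <= ht x -> pos x.
Proof.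
by move=> xP x_ge0; case: (pos_or_neg xP) => // -[_]; rewrite dotNr oppr_gt0 ltNge x_ge0.
Qed.

Lemma pos_root x : pos x -> x \in Phi. Proof. by case. Qed.

Lemma pos_nz x : pos x -> x != 0. Proof. by move/pos_root/root_nz. Qed.

Lemma base_pos b : b \in Delta -> pos b.
Proof. by move=> bD; split; rewrite ?base_root ?rho_base. Qed.

(** A positive root other than [b] has a positive coordinate along a simple root
    [b'] other than [b], since [Phi] is reduced; the reflection in [b] does not
    change that coordinate, and a root has coordinates of only one sign. *)
Lemma simple_refl_pos b x : b \in Delta -> pos x -> x != b -> pos (refl b *m x).
Proof.
move=> bD xpos xb; have [xP x_gt0] := xpos; have [c xE] := pos_comb xpos.
have yP : refl b *m x \in Phi by apply: root_refl => //; apply: base_root.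
have [//|yneg] := pos_or_neg yP; have [d yE] := pos_comb yneg.
have c0 b' : b' \in Delta -> b' != b -> c b' = 0%N.
  (* [r] is the coordinate along [b']: [c b'] on [x], at most 0 on the reflected root. *)
  move=> b'D b'b; have [r rE] := base_dual (fun e => (e == b')%:R).
  have rc (e : 'cV[R]_n -> nat) : dot r (\sum_(b <- Delta) b *+ e b) = (e b')%:R.
    rewrite dot_sumr (bigD1_seq b') ?fset_uniq //= dotMnr rE // eqxx big_seq_cond.
    rewrite big1 ?addr0 // => e' /andP[e'D /negbTE e'b'].
    by rewrite dotMnr rE // e'b' mul0rn.
  have : dot r (refl b *m x) = (c b')%:R.
    by rewrite reflE dotBr dotZr (rE _ bD) eq_sym (negbTE b'b) mulr0 subr0 xE rc.
  rewrite -[_ *m x]opprK yE dotNr rc => cd.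
  apply/eqP; rewrite -(eqr_nat R) eq_le ler0n andbT -cd oppr_le0 ler0n //.
have xcb : x = (c b)%:R *: b.
  rewrite xE (bigD1_seq b) ?fset_uniq //= big_seq_cond big1 => [|e /andP[eD eb]].
    by rewrite addr0 scaler_nat.
  by rewrite c0 ?mulr0n.
have [c1|c1] : (c b)%:R = 1 :> R \/ (c b)%:R = -1 :> R.
- by apply: Phi_reduced (base_root bD) _; rewrite -xcb.
- by move: xb; rewrite xcb c1 scale1r eqxx.
- by move: (ler0n R (c b)); rewrite c1 ler0N1.
Qed.

(** A positive root has a positive inner product with some simple root, and the
    reflection in that simple root lowers its height; so induction on the height
    reaches every root from the simple ones. *)
Lemma root_ind (P : 'cV[R]_n -> Prop) :
  (forall b, b \in Delta -> P b) ->
  (forall b x, b \in Delta -> x \in Phi -> P x -> P (refl b *m x)) ->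
  forall x, x \in Phi -> P x.
Proof.
move=> Pb Prefl.
have Pneg b : b \in Delta -> P (- b).
  by move=> bD; rewrite -refl_id ?root_nz ?base_root //; apply: Prefl (Pb b bD); rewrite ?base_root.
suff IH k x : pos x -> ht x < k%:R -> P x /\ P (- x).
  move=> x xP.
  have up y : pos y -> P y /\ P (- y).
    move=> ypos; have [c yE] := pos_comb ypos.
    by apply: (IH (\sum_(b <- Delta) c b).+1) => //; rewrite yE ht_comb ltr_nat.
  by case: (pos_or_neg xP) => /up[] //; rewrite opprK.
elim: k x => [|k IHk] x xpos; first by case: xpos => _ /ltW; rewrite leNgt => /negbTE->.
move=> xk; have [c xE] := pos_comb xpos.
have [/hasP[b bD xb]|/hasPn noB] := boolP (has (fun b => 0 < dot x b) Delta); last first.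
  have := dot_gt0 (pos_nz xpos); rewrite {2}xE dot_sumr ltNge big_seq sumr_le0 // => b bD.
  by rewrite dotMnr mulrn_wle0 // leNgt noB.
have [->|x_b] := eqVneq x b; first by split; [exact: Pb|exact: Pneg].
have bP := base_root bD; have b0 := root_nz bP.
have ypos := simple_refl_pos bD xpos x_b; set y := refl b *m x in ypos.
have yx : ht y < ht x.
  rewrite /y reflE dotBr dotZr (rho_base bD) mulr1 ltrBlDr ltrDl.
  by rewrite /cartan divr_gt0 ?dot_gt0 ?mulr_gt0.
have [|Py PNy] := IHk y ypos.
  have [d yE] := pos_comb ypos; move: xk yx; rewrite xE yE !ht_comb !ltr_nat ltnS => xk yx.
  exact: leq_trans yx xk.
have xy : x = refl b *m y by rewrite refl_actK.
have xyN : - x = refl b *m (- y) by rewrite mulmxN -xy.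
have yP := pos_root ypos.
by split; [rewrite xy|rewrite xyN]; apply: Prefl => //; apply: rootN.
Qed.

(** * Words in the simple reflections *)

Notation W := (weyl_group Phi).
Notation len := (coxeter_length Delta).
Notation word s := {subset s <= Delta}.
Notation eval s := (\prod_(b <- s) refl b).

Lemma has_wordP w k :
  reflect (exists2 s : seq 'cV[R]_n, word s & size s = k /\ w = eval s)
          (has_word Delta w k).
Proof.
apply: (iffP existsP) => [[t /eqP wE]|[s sD [sk wE]]].
  exists (map val t); last by rewrite size_map size_tuple big_map.
  by move=> _ /mapP[b _ ->]; apply: valP.
have [t ts] : exists t : seq Delta, map val t = s.
  elim: s sD {sk wE} => [|b s IHs] sD; first by exists [::].
  have [|t ts] := IHs; first by move=> a aS; rewrite sD // inE aS orbT.
  have bD : b \in Delta by rewrite sD // mem_head.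
  by exists (FSetSub bD :: t); rewrite /= ts.
have tk : size t == k by rewrite -sk -ts size_map.
by exists (Tuple tk); rewrite wE -ts big_map.
Qed.

Lemma W_refl a : a \in Phi -> W (refl a).
Proof. by move=> aP; exists [:: a] => [b|]; rewrite ?inE ?big_seq1 // => /eqP->. Qed.

Lemma W_mul u v : W u -> W v -> W (u * v).
Proof.
move=> [s sP ->] [t tP ->]; exists (s ++ t); last by rewrite big_cat.
by move=> a; rewrite mem_cat => /orP[/sP|/tP].
Qed.

Lemma W_root u x : W u -> x \in Phi -> u^T *m x \in Phi.
Proof.
move=> [s sP ->] {u}; elim: s sP x => [|a s IHs] sP x xP.
  by rewrite big_nil trmx1 mul1mx.
rewrite big_cons refl_tr_mul actM; apply: IHs => [b bs|].
  by rewrite sP // inE bs orbT.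
by apply: root_refl => //; rewrite sP ?mem_head.
Qed.

Lemma word_cat s t : word s -> word t -> word (s ++ t).
Proof. by move=> sD tD a; rewrite mem_cat => /orP[/sD|/tD]. Qed.

Lemma word_cons b s : b \in Delta -> word s -> word (b :: s).
Proof. by move=> bD sD a; rewrite inE => /orP[/eqP->|/sD]. Qed.

Lemma refl_word a : a \in Phi -> exists2 s, word s & refl a = eval s.
Proof.
move: a; apply: root_ind => [b bD|b x bD xP [s sD xE]].
  by exists [:: b]; [exact: word_cons|rewrite big_seq1].
exists (b :: s ++ [:: b]).
  by apply: word_cons => //; apply: word_cat => //; apply: word_cons.
by rewrite refl_conj ?root_nz ?base_root // big_cons big_cat big_seq1 xE mulrA.
Qed.

Lemma W_word u : W u -> exists2 s, word s & u = eval s.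
Proof.
move=> [s sP ->] {u}; elim: s sP => [|a s IHs] sP; first by exists [::]; rewrite ?big_nil.
have [|t tD tE] := IHs; first by move=> b bs; rewrite sP // inE bs orbT.
have [r rD rE] := refl_word (sP a (mem_head _ _)).
by exists (r ++ t); rewrite ?big_cat ?big_cons ?rE ?tE //; apply: word_cat.
Qed.

Lemma len_le s : word s -> (len (eval s) <= size s)%N.
Proof.
move=> sD; rewrite /coxeter_length; case: pselect => // ex_word.
by case: ex_minnP => k _; apply; apply/has_wordP; exists s.
Qed.

Lemma reduced_word u : W u -> exists2 s, word s & size s = len u /\ u = eval s.
Proof.
move=> /W_word[s sD uE]; rewrite /coxeter_length; case: pselect => [ex_word|].
  by case: ex_minnP => k /has_wordP.
by case; exists (size s); apply/has_wordP; exists s.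
Qed.

Lemma refl_mulK a u : a \in Phi -> refl a * (refl a * u) = u.
Proof. by move=> aP; rewrite mulrA reflK ?root_nz // mul1r. Qed.

(** The exchange property.  Following [x] through the inverses of the letters,
    the first letter that makes it negative is the reflection in its current
    value, because a simple reflection changes the sign of only one positive
    root; deleting that letter multiplies the word by the reflection in [x]. *)
Lemma exchange s x : word s -> pos x -> ~ pos ((eval s)^T *m x) ->
  exists2 t, word t & (size t).+1 = size s /\ refl x * eval s = eval t.
Proof.
elim: s x => [|b s IHs] x sD xpos xneg.
  by case: xneg; rewrite big_nil trmx1 mul1mx.
have bD : b \in Delta by rewrite sD ?mem_head.
have s'D : word s by move=> a aS; rewrite sD // inE aS orbT.
have bP := base_root bD; have b0 := root_nz bP.
have [->|xb] := eqVneq x b.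
  by exists s; rewrite // big_cons refl_mulK.
have ypos := simple_refl_pos bD xpos xb.
have [|t tD [ts tE]] := IHs _ s'D ypos.
  by move: xneg; rewrite big_cons refl_tr_mul actM.
exists (b :: t); first exact: word_cons.
split; first by rewrite /= ts.
by rewrite !big_cons -tE refl_conj // -!mulrA refl_mulK.
Qed.

(** If [u^-1 a] is positive then [refl a * u] sends [a] to a negative root under
    its inverse, so [exchange] shortens a reduced word of it. *)
Lemma len_refl a u : W u -> pos a -> pos (u^T *m a) -> (len u < len (refl a * u))%N.
Proof.
move=> uW apos uapos; have aP := pos_root apos.
have wW : W (refl a * u) by apply: W_mul => //; apply: W_refl.
have [s sD [sk wE]] := reduced_word wW.
have [|t tD [ts tE]] := exchange sD apos.
  rewrite -wE refl_tr_mul actM refl_id ?root_nz // mulmxN => -[_].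
  by case: uapos => _; rewrite dotNr oppr_gt0 => /ltW; rewrite leNgt => /negP.
by rewrite -sk -ts ltnS -[u in len u](refl_mulK u aP) wE tE len_le.
Qed.

Lemma len_refl_pos a u : W u -> pos a -> (len u < len (refl a * u))%N -> pos (u^T *m a).
Proof.
move=> uW apos lt_len; have aP := pos_root apos.
have [//|neg] := pos_or_neg (W_root uW aP).
have: (len (refl a * u) < len u)%N; last by rewrite ltnNge ltnW.
rewrite -[u in (_ < len u)%N](refl_mulK u aP); apply: len_refl => //.
  by apply: W_mul => //; apply: W_refl.
by rewrite refl_tr_mul actM refl_id ?root_nz // mulmxN.
Qed.

(** * Bruhat order *)

Lemma bruhat_lt_step a u : W u -> pos a -> pos (u^T *m a) -> bruhat_lt Phi Delta u (refl a * u).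
Proof.
move=> uW apos uapos; have lt_len := len_refl uW apos uapos; split.
  by apply: rt_step; exists a => //; apply: pos_root.
by move=> eq_u; rewrite -eq_u ltnn in lt_len.
Qed.

Lemma bruhat_lt_len u w : bruhat_lt Phi Delta u w -> (len u < len w)%N.
Proof.
have le_len u' w' : bruhat_le Phi Delta u' w' -> u' = w' \/ (len u' < len w')%N.
  elim=> [x y [a _ [_ xy]]|x|x y z _ [->|xy] _ [<-|yz]]; try by [left|right].
  by right; apply: ltn_trans yz.
by case=> /le_len[].
Qed.

Lemma bruhat_lt_trans u v w : bruhat_lt Phi Delta u v -> bruhat_lt Phi Delta v w ->
  bruhat_lt Phi Delta u w.
Proof.
move=> uv vw; have := ltn_trans (bruhat_lt_len uv) (bruhat_lt_len vw).
case: uv vw => uv _ [vw _] lt_len; split; first exact: rt_trans vw.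
by move=> eq_uw; rewrite eq_uw ltnn in lt_len.
Qed.

(** The first step of a chain from [u] to [w] already reaches [w], for otherwise
    its end would lie strictly between them. *)
Lemma bruhat_cover_step u w : W u -> bruhat_cover Phi Delta u w ->
  exists2 a, pos a & w = refl a * u /\ pos (u^T *m a).
Proof.
move=> uW [[uw neq_uw] no_mid].
have : bruhat_step Phi Delta u w.
  have path_uw := clos_rt_rt1n _ _ _ _ uw.
  case: path_uw neq_uw no_mid {uw} => [//|z w' uz zw] _ no_mid.
  have [<-//|/eqP zw'] := eqVneq z w'.
  have [a aP [zE lt_len]] := uz.
  case: no_mid; exists z; first by rewrite zE; apply: W_mul => //; apply: W_refl.
  split; split=> //; first exact: rt_step.
    by move=> eq_uz; rewrite -eq_uz ltnn in lt_len.
  exact: clos_rt1n_rt.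
case=> a aP [wE lt_len]; rewrite wE in lt_len *.
have [apos|apos] := pos_or_neg aP; [exists a|exists (- a)]; rewrite // ?reflN; split=> //.
  exact: len_refl_pos.
by apply: len_refl_pos uW apos _; rewrite reflN.
Qed.

(** * Simply laced root systems *)

Hypotheses (Phi_irr : irreducible Phi) (Delta_sl : simply_laced Delta).

(** Cartan numbers are integers, so two of them with product 1 are equal; and the
    ratio of the two Cartan numbers of [a] and [b] is that of their squared
    lengths. *)
Lemma base_orth a b : a \in Delta -> b \in Delta -> dot a a != dot b b -> dot a b = 0.
Proof.
move=> aD bD; apply: contra_neq_eq => ab0.
have a_gt0 := dot_gt0 (root_nz (base_root aD)).
have b_gt0 := dot_gt0 (root_nz (base_root bD)).
have [->//|neq_ab] := eqVneq a b.
have := Delta_sl aD bD neq_ab; rewrite /dynkin_edges.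
have := root_int Phi_root (base_root bD) (base_root aD).
have := root_int Phi_root (base_root aD) (base_root bD).
have p0 : cartan a b != 0 by rewrite /cartan !mulf_neq0 ?invr_neq0 ?pnatr_eq0 ?(gt_eqF b_gt0).
have q0 : cartan b a != 0 by rewrite /cartan dotC !mulf_neq0 ?invr_neq0 ?pnatr_eq0 ?(gt_eqF a_gt0).
move=> /norm_intr_ge1/(_ q0) q1 /norm_intr_ge1/(_ p0) p1 [/eqP|pq1].
  by rewrite mulf_eq0 (negbTE p0) (negbTE q0).
have pq : cartan a b = cartan b a.
  move: p1 q1 pq1; move: (cartan a b) (cartan b a) => p q.
  by rewrite !ler_normr => /orP[p1|p1] /orP[q1|q1] pq1; nra.
have ca : cartan a b * dot b b = 2 * dot a b by rewrite /cartan divfK ?gt_eqF.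
have cb : cartan b a * dot a a = 2 * dot a b by rewrite /cartan dotC divfK ?gt_eqF.
by apply: (mulfI q0); rewrite cb -ca pq.
Qed.

(** The roots of the length of one simple root that are orthogonal to the simple
    roots of other lengths are orthogonal to all other roots, so irreducibility
    makes them all of [Phi]: a simply laced system has a single root length. *)
Lemma root_norm : exists2 L, 0 < L & forall x, x \in Phi -> dot x x = L.
Proof.
have [Phi_neq0 Phi_split] := Phi_irr.
have [b0 b0D] : exists b0, b0 \in Delta.
  have [D0|[b0 b0D]] := fset_0Vmem Delta; last by exists b0.
  have [P0|[x xP]] := fset_0Vmem Phi; first by case: Phi_neq0.
  suff [] : False by [].
  by move: x xP; apply: root_ind => // b; rewrite D0 inE.
pose L := dot b0 b0; exists L; first exact/dot_gt0/root_nz/base_root.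
pose K x := dot x x = L /\ forall b, b \in Delta -> dot b b != L -> dot x b = 0.
have Kbase b : b \in Delta -> dot b b = L -> K b.
  by move=> bD bL; split=> // b' b'D b'L; apply: base_orth; rewrite // bL eq_sym.
have Kdich x : x \in Phi -> K x \/ forall y, K y -> dot y x = 0.
  move: x; apply: root_ind => [b bD|b x bD xP].
    have [/(Kbase b bD)|bL] := eqVneq (dot b b) L; first by left.
    by right=> y [_]; apply.
  have b_nz := root_nz (base_root bD).
  have [bL|bL] := eqVneq (dot b b) L; case=> Kx.
  - left; split; first by rewrite dot_refl_refl //; case: Kx.
    move=> b' b'D b'L; rewrite reflE dotC dotBr dotZr dotC; case: Kx => _ -> //.
    by rewrite (base_orth b'D bD) ?bL // mulr0 subr0.
  - right=> y Ky; rewrite reflE /cartan (dotC x) (Kx b (Kbase b bD bL)).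
    by rewrite mulr0 mul0r scale0r subr0 Kx.
  - left; rewrite reflE /cartan; have [_ -> //] := Kx.
    by rewrite mulr0 mul0r scale0r subr0.
  - right=> y Ky; rewrite reflE dotBr dotZr Kx //; have [_ -> //] := Ky.
    by rewrite mulr0 subr0.
pose A := [fset x in Phi | `[< K x >]]%fset.
have AE x : (x \in A) = (x \in Phi) && `[< K x >] by rewrite !inE.
have b0A : b0 \in A by rewrite AE base_root //=; apply/asboolP/Kbase.
have [||A0|AP] := Phi_split A; last by move=> x; rewrite -AP AE => /andP[_ /asboolP[]].
- by apply/fsubsetP => x; rewrite AE => /andP[].
- move=> a b; rewrite AE in_fsetD AE => /andP[_ /asboolP Ka] /andP[+ bP].
  by rewrite bP /= => /asboolP nKb; case: (Kdich b bP) => // /(_ a Ka).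
- by rewrite A0 in b0A.
Qed.

Lemma cartanC x y : x \in Phi -> y \in Phi -> cartan x y = cartan y x.
Proof. by move=> xP yP; have [L _ nL] := root_norm; rewrite /cartan dotC !nL. Qed.

(** [x + y] and [x - y] have positive squared length, and the lengths of [x] and
    [y] are equal, so the integer [cartan x y] lies strictly between -2 and 2. *)
Lemma cartan_cases x y : x \in Phi -> y \in Phi -> x != y -> x != - y ->
  [\/ cartan x y = -1, cartan x y = 0 | cartan x y = 1].
Proof.
move=> xP yP xy xNy; have [L L0 nL] := root_norm.
have /intrP[m mE] := root_int Phi_root yP xP.
have := dot_gt0 (_ : x - y != 0); rewrite subr_eq0 xy => /(_ isT).
have := dot_gt0 (_ : x + y != 0); rewrite addr_eq0 xNy => /(_ isT).
rewrite !(dotDl, dotDr, dotNl, dotNr) (dotC y x) !nL // => sum_gt0 diff_gt0.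
have mL : m%:~R * L = 2 * dot x y by rewrite -mE /cartan nL // divfK ?gt_eqF.
have m2 : (m%:~R : R) < 2 by rewrite -(ltr_pM2r L0) mL; lra.
have m_2 : - 2 < (m%:~R : R) by rewrite -(ltr_pM2r L0) mL; lra.
rewrite mE; move: m2 m_2; rewrite -[2]/((2%:Z)%:~R) -intrN !ltr_int.
by case: m {mE mL} => [[|[|m]]|[|m]] // _ _; [apply: Or32|apply: Or33|apply: Or31].
Qed.

Lemma cartan_le1 x y : x \in Phi -> y \in Phi -> x != y -> cartan x y <= 1.
Proof.
move=> xP yP xy; have [->|xNy] := eqVneq x (- y).
  by rewrite cartanNl cartan_id ?root_nz //; lra.
by case: (cartan_cases xP yP xy xNy) => ->; lra.
Qed.

Lemma pos_neqN x y : pos x -> pos y -> x != - y.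
Proof.
move=> [_ x0] [_ y0]; apply: contraTneq x0 => ->.
by rewrite dotNr oppr_gt0 ltNge ltW.
Qed.

Lemma cartan_neg x y : pos x -> pos y -> cartan x y < 0 -> cartan x y = -1.
Proof.
move=> xpos ypos xy0; have [xP yP] := (pos_root xpos, pos_root ypos).
have xy : x != y by apply: contraTneq xy0 => ->; rewrite cartan_id ?root_nz // -leNgt.
by case: (cartan_cases xP yP xy (pos_neqN xpos ypos)) => // xyE; move: xy0; rewrite xyE; lra.
Qed.

Lemma posD x y : pos x -> pos y -> x + y \in Phi -> pos (x + y).
Proof. by move=> [_ x0] [_ y0] xyP; split=> //; rewrite dotDr addr_gt0. Qed.

(** * Splitting a root along the pivot *)

Section PivotSplit.
Context (beta phi : 'cV[R]_n).
Hypotheses (beta_D : beta \in Delta) (phi_beta : 0 < dot phi beta).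
Hypothesis phi_base : forall b, b \in Delta -> b != beta -> dot phi b < 0.

(** Simple roots other than [beta] have these properties, and so does any root
    that is a sum of two roots having them. *)
Definition outer p : Prop := [/\ pos p, dot phi p < 0 & dot p beta <= 0].

Lemma outer_decomposition a : pos a ->
  exists m (s : seq 'cV[R]_n), (forall p, p \in s -> outer p) /\
    a = beta *+ m + \sum_(p <- s) p.
Proof.
move=> /pos_comb[c ->]; exists (c beta).
have expand r : {subset r <= Delta} -> exists s : seq 'cV[R]_n,
    (forall p, p \in s -> p \in Delta /\ p != beta) /\
    \sum_(b <- r | b != beta) b *+ c b = \sum_(p <- s) p.
  elim: r => [|b r IHr] rD.
    by exists [::]; split=> //; rewrite !big_nil.
  have [|s [sD sE]] := IHr; first by move=> x xr; rewrite rD // inE xr orbT.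
  rewrite big_cons; have [_|bb] := eqVneq b beta; first by exists s.
  exists (nseq (c b) b ++ s); split; last by rewrite sE big_cat big_nseq iter_addr_0.
  move=> p; rewrite mem_cat mem_nseq => /orP[/andP[_ /eqP->]|/sD//].
  by rewrite rD ?mem_head.
have [//|s [sD sE]] := expand (enum_fset Delta).
exists s; split; last by rewrite (bigD1_seq beta) ?fset_uniq //= sE.
move=> p /sD[pD pb]; split; [exact: base_pos|exact: phi_base|].
rewrite leNgt; apply/negP => pb0.
have ppos := base_pos pD; have bpos := base_pos beta_D.
have ypos := simple_refl_pos beta_D ppos pb.
have pb1 : cartan p beta = 1.
  have c0 : 0 < cartan p beta by rewrite /cartan divr_gt0 ?mulr_gt0 ?dot_gt0 ?(pos_nz bpos).
  have := cartan_cases (pos_root ppos) (pos_root bpos) pb (pos_neqN ppos bpos).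
  by case=> // cE; move: c0; rewrite cE; lra.
by case: ypos => _; rewrite reflE pb1 scale1r dotBr !rho_base // subrr ltxx.
Qed.

(** Take the decomposition with the fewest terms.  If a term [i] is orthogonal
    to [beta], no other term has negative pairing with [i], since the sum of such
    a term and [i] is an outer root and could replace the two; then [a] pairs
    with [i] to at least 2, which forces [a = i], although [phi] takes opposite
    signs on the two. *)
Lemma outer_linked a m (s : seq 'cV[R]_n) : a \in Phi -> 0 < dot phi a ->
  (forall p, p \in s -> outer p) -> a = beta *+ m + \sum_(p <- s) p ->
  exists2 s', (forall p, p \in s' -> outer p /\ dot p beta != 0) &
    a = beta *+ m + \sum_(p <- s') p.
Proof.
move=> aP phi_a; have [k] := ubnP (size s); elim: k s => // k IHk s sk s_out aE.
have [/hasP[i i_s /eqP ib]|/hasPn s_b] := boolP (has (fun p => dot p beta == 0) s); last first.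
  by exists s => // p p_s; split; [exact: s_out|exact: s_b].
have [ipos phi_i _] := s_out i i_s; have iP := pos_root ipos.
have s1_s := mem_rem (x := i) (s := s).
have s1k : (size (rem i s)).+1 = size s.
  by rewrite size_rem // prednK // -has_predT; apply/hasP; exists i.
have [/hasP[p p_s1 pi0]|/hasPn s_i] := boolP (has (fun p => cartan p i < 0) (rem i s)).
  have [ppos phi_p pb] := s_out p (s1_s _ p_s1).
  have pi1 := cartan_neg ppos ipos pi0.
  have piE : p + i = refl i *m p by rewrite reflE pi1 scaleN1r opprK.
  apply: (IHk (p + i :: rem p (rem i s))).
  - by rewrite /= size_rem // prednK; [rewrite -ltnS s1k|rewrite -has_predT; apply/hasP; exists p].
  - move=> q; rewrite inE => /orP[/eqP->|q_s]; last by apply/s_out/s1_s/(mem_rem q_s).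
    split; last by rewrite dotDl ib addr0.
      by apply: posD; rewrite // piE; apply: root_refl => //; apply: pos_root.
    by rewrite dotDr; lra.
  - rewrite aE (big_rem i) //= (big_rem p p_s1) /= big_cons.
    by rewrite [p + i]addrC !addrA.
have ai : a != i by apply: contraTneq phi_a => ->; rewrite -leNgt ltW.
have := cartan_le1 aP iP ai; rewrite leNgt => /negP[].
rewrite aE (big_rem i) //= !cartanDl cartanMnl cartan_id ?(pos_nz ipos) // cartan_sum.
have -> : cartan beta i = 0 by rewrite /cartan dotC ib mulr0 mul0r.
rewrite mul0rn add0r ltr_wpDr ?ltr1n // big_seq sumr_ge0 // => p /s_i.
by rewrite -leNgt.
Qed.

(** Write [a = beta *+ m + \sum p] with every [p] linked to [beta].  Pairing with
    [a] gives [\sum cartan p a = m + 2], because [cartan beta a = -1].  If [phi]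
    were nonpositive on [p + beta] whenever [cartan p a = 1], then [phi p] would
    be at most [- phi beta * cartan p a] for all [p], and [phi a] at most
    [m * phi beta - (m + 2) * phi beta], which is negative. *)
Lemma pivot_split a : pos a -> 0 < dot phi a -> cartan a beta = -1 ->
  exists j, [/\ pos j, pos (a - j), cartan j a = 1, cartan j beta = -1 &
                dot phi j < 0 /\ 0 < dot phi (j + beta)].
Proof.
move=> apos phi_a ab; have aP := pos_root apos; have a0 := root_nz aP.
have bpos := base_pos beta_D; have bP := pos_root bpos.
have [m [s0 [s0_out aE0]]] := outer_decomposition apos.
have [s s_out aE] := outer_linked aP phi_a s0_out aE0.
have s_a p : p \in s -> cartan p a <= 1.
  move=> /s_out[[/pos_root pP phi_p _] _]; apply: cartan_le1 => //.
  by apply: contraTneq phi_p => ->; rewrite -leNgt ltW.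
have sum_s : \sum_(p <- s) cartan p a = m%:R + 2.
  have := cartan_id a0; rewrite {1}aE cartanDl cartanMnl cartan_sum cartanC // ab.
  by rewrite mulNrn => <-; rewrite addrA subrr add0r.
have [/hasP[j js /andP[/eqP ja phi_j]]|/hasPn no_j] :=
    boolP (has (fun p => (cartan p a == 1) && (0 < dot phi (p + beta))) s).
  have [[jpos phi_j0 jb] jb0] := s_out j js; have jP := pos_root jpos.
  exists j; split=> //.
    have ajP : a - j \in Phi.
      have -> : a - j = refl j *m a by rewrite reflE cartanC // ja scale1r.
      exact: root_refl.
    apply: ht_ge0_pos => //; rewrite aE (big_rem j) //= addrCA addrAC subrr add0r.
    rewrite dotDr dotMnr rho_base // dot_sumr addr_ge0 ?mulrn_wge0 //.
    rewrite big_seq sumr_ge0 // => p /(mem_rem)/s_out[[[_ p0] _ _] _].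
    exact: ltW.
  apply: cartan_neg => //; rewrite /cartan -mulrA pmulr_rlt0 // nmulr_rlt0.
    by rewrite invr_gt0 dot_gt0 ?root_nz.
  by rewrite lt_neqAle jb0.
have : \sum_(p <- s) dot phi p <= \sum_(p <- s) - dot phi beta * cartan p a.
  rewrite !big_seq; apply: ler_sum => p ps.
  have [[ppos phi_p pb] _] := s_out p ps; have := s_a p ps.
  have [pa _|pa _] := eqVneq (cartan p a) 1.
    have := no_j p ps; rewrite pa eqxx /= -leNgt dotDr; lra.
  have pNa := pos_neqN ppos apos.
  have p_a : p != a by apply: contraTneq phi_p => ->; rewrite -leNgt ltW.
  have [ca|ca|ca] := cartan_cases (pos_root ppos) aP p_a pNa.
  - by rewrite ca mulrN1 opprK; apply/ltW/(lt_trans phi_p).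
  - by rewrite ca mulr0 ltW.
  - by rewrite ca eqxx in pa.
rewrite -mulr_sumr sum_s -dot_sumr => sum_le; exfalso.
move: phi_a sum_le; rewrite {1}aE dotDr dotMnr -(mulr_natl (dot phi beta)).
move: phi_beta; nra.
Qed.

End PivotSplit.

(** * Covers of a shuffle element multiplied by its pivot *)

(** [w^-1 beta > 0] is refuted: the two summands [j] and [y] of [a] given by
    [pivot_split] both stay positive under [u^-1], and the three reflections
    [j], [y], [j], applied in turn to [u], lengthen it each time and lead to [w]. *)
Lemma cover_descent v beta w : W v -> is_pivot Phi Delta v beta -> W w ->
  bruhat_cover Phi Delta (refl beta * v) w -> bruhat_lt Phi Delta (refl beta * w) w.
Proof.
move=> vW [/eqP/cardfs1P[e ascE] beta_asc] wW cover_w.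
have ascP b : (b \in left_ascents Phi Delta v) =
    (b \in Delta) && `[< bruhat_lt Phi Delta v (refl b * v) >].
  by rewrite /left_ascents !inE.
have /andP[bD /asboolP v_lt] : (beta \in Delta) && `[< bruhat_lt Phi Delta v (refl beta * v) >].
  by rewrite -ascP.
have bpos := base_pos bD; have bP := pos_root bpos; have b0 := root_nz bP.
pose phi := v *m rho.
have phiE x : dot phi x = ht (v^T *m x) by rewrite dot_mulmx trmxK.
have phi_pos x : x \in Phi -> 0 < dot phi x -> pos (v^T *m x).
  by move=> xP x0; split; [exact: W_root|rewrite -phiE].
have phi_beta : 0 < dot phi beta.
  by rewrite phiE; case: (len_refl_pos vW bpos (bruhat_lt_len v_lt)).
have phi_base b : b \in Delta -> b != beta -> dot phi b < 0.
  move=> b_D bb; rewrite phiE.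
  case: (pos_or_neg (W_root vW (base_root b_D))) => [vb|[_]]; last by rewrite dotNr oppr_gt0.
  have b_asc : b \in left_ascents Phi Delta v.
    by rewrite ascP b_D; apply/asboolP/bruhat_lt_step => //; apply: base_pos.
  by move: b_asc beta_asc bb; rewrite ascE !inE => /eqP-> /eqP->; rewrite eqxx.
set u := refl beta * v in cover_w.
have uW : W u by apply: W_mul => //; apply: W_refl.
have uE x : u^T *m x = v^T *m (refl beta *m x) by rewrite /u refl_tr_mul actM.
have [a apos [wE ua_pos]] := bruhat_cover_step uW cover_w.
have aP := pos_root apos.
have [wb_pos|wb_neg] := pos_or_neg (W_root wW bP); last first.
  rewrite -[X in bruhat_lt _ _ _ X](refl_mulK w bP).
  apply: bruhat_lt_step => //; first by apply: W_mul => //; apply: W_refl.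
  by rewrite refl_tr_mul actM refl_id // mulmxN.
exfalso.
have ub : ht (u^T *m beta) < 0 by rewrite uE refl_id // mulmxN dotNr -phiE oppr_lt0.
have wbE : w^T *m beta = u^T *m (beta - cartan beta a *: a).
  by rewrite wE refl_tr_mul actM reflE.
have ba : cartan beta a = -1.
  apply: cartan_neg => //; rewrite ltNge; apply/negP => ba.
  move: wb_pos ua_pos => [_ +] [_]; rewrite wbE mulmxBr -scalemxAr dotBr dotZr.
  nra.
have ab : cartan a beta = -1 by rewrite cartanC.
have phi_a : 0 < dot phi a.
  case: wb_pos => _; rewrite wbE uE phiE ba scaleN1r opprK mulmxDr refl_id //.
  by rewrite reflE ab scaleN1r opprK addrC addrK.
have [j [jpos ypos ja jb [phi_j phi_jb]]] := pivot_split bD phi_beta phi_base apos phi_a ab.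
set y := a - j in ypos; have jP := pos_root jpos; have yP := pos_root ypos.
have j0 := root_nz jP; have aj : cartan a j = 1 by rewrite cartanC.
have ay : refl j *m a = y by rewrite reflE aj scale1r.
have ya : refl j *m y = a by rewrite -ay refl_actK.
have uj_pos : pos (u^T *m j).
  rewrite uE; apply: phi_pos; first exact: root_refl.
  by rewrite reflE jb scaleN1r opprK.
have uy_pos : pos (u^T *m y).
  rewrite uE; apply: phi_pos; first exact: root_refl.
  rewrite reflE cartanDl cartanNl ab jb subrr scale0r subr0 dotBr.
  lra.
pose z1 := refl j * u; pose z2 := refl y * z1.
have z1W : W z1 by apply: W_mul => //; apply: W_refl.
have z2W : W z2 by apply: W_mul => //; apply: W_refl.
have wz : w = refl j * z2 by rewrite wE -ya refl_conj // /z2 /z1 !mulrA.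
have u_z1 : bruhat_lt Phi Delta u z1 by apply: bruhat_lt_step.
have z1_z2 : bruhat_lt Phi Delta z1 z2.
  by apply: bruhat_lt_step => //; rewrite refl_tr_mul actM ya.
have z2_w : bruhat_lt Phi Delta z2 w.
  rewrite wz; apply: bruhat_lt_step => //.
  rewrite refl_tr_mul actM refl_tr_mul actM.
  have -> : refl j *m (refl y *m j) = y; last by [].
  have jy : cartan j y = -1 by rewrite cartanC // cartanDl cartanNl aj cartan_id //; lra.
  by rewrite (reflE y) jy scaleN1r opprK addrC subrK ay.
case: cover_w => _ []; exists z1 => //; split=> //.
exact: bruhat_lt_trans z1_z2 z2_w.
Qed.

End RootSystem.

Theorem theoremA27 (R : realType) (n : nat) (Phi Delta : {fset 'cV[R]_n})
    (Phi_root : root_system Phi) (Phi_reduced : reduced Phi)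
    (Phi_irr : irreducible Phi) (Delta_base : is_base Phi Delta)
    (Delta_sl : simply_laced Delta)
    (v : 'M[R]_n) (v_W : weyl_group Phi v)
    (v_shuffle : is_shuffle Phi Delta v)
    (beta : 'cV[R]_n) (beta_pivot : is_pivot Phi Delta v beta)
    (w : 'M[R]_n) (w_W : weyl_group Phi w)
    (cover_w : bruhat_cover Phi Delta (refl beta * v) w) :
  bruhat_lt Phi Delta (refl beta * w) w.
Proof.
have [rho rho_base] := base_dual Delta_base (fun=> 1).
exact: (cover_descent Phi_root Phi_reduced Delta_base rho_base Phi_irr Delta_sl
  v_W beta_pivot w_W cover_w).
Qed.
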